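(* Let $A$ be a $V\times V$-matrix over $GF(4)$ (with $V$ finite) that is $\mathrm{inv}$-symmetric, i.e. $\mathrm{inv}(-A^T)=A$. Then $A$ is principally unimodular, i.e. $\det(A[Y])\in\{0,1,-1\}$ for all $Y\subseteq V$.
   Context: $\mathrm{inv}$ denotes the unique nontrivial field automorphism of $GF(4)$, given by $x\mapsto x^2$ (equivalently $x\mapsto x^{-1}$ for $x\neq 0$), applied entrywise to matrices. For $Y\subseteq V$, $A[Y]$ is the principal submatrix with rows and columns indexed by $Y$; the determinant of the empty matrix is $1$. Note $-1=1$ in $GF(4)$. *)

(* Defs.v *)
From HB Require Import structures.
From mathcomp Require Import all_boot all_order all_algebra all_fingroup all_field.

Set Implicit Arguments.
Unset Strict Implicit.
Unset Printing Implicit Defensive.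

Import GRing.Theory.
Local Open Scope ring_scope.

(* A V x V matrix, for an arbitrary finite V, is a function V -> V -> F. Only
   principal submatrices are turned into 'M[F]_n; their determinants do not
   depend on the enumeration used, as the same one indexes rows and columns. *)

Definition trV (V : finType) (F : Type) (A : V -> V -> F) : V -> V -> F :=
  fun u v => A v u.

Definition principal_submx (V : finType) (F : Type) (A : V -> V -> F)
    (Y : {set V}) : 'M[F]_#|Y| :=
  \matrix_(i, j) A (enum_val i) (enum_val j).

Definition principally_unimodular (V : finType) (F : fieldType)
    (A : V -> V -> F) : Prop :=
  forall Y : {set V}, \det (principal_submx A Y) \in [:: 0; 1; -1].

(* GF(4) is any finite field F with #|F| = 4; the lemmas below check that
   squaring is then its unique nontrivial automorphism. *)
Definition GF4_inv (F : fieldType) (x : F) : F := x ^+ 2.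

Definition inv_symmetric (V : finType) (F : fieldType)
    (A : V -> V -> F) : Prop :=
  forall u v : V, GF4_inv (- trV A u v) = A u v.

Lemma GF4_pchar2 (F : finFieldType) : #|F| = 4%N -> 2%N \in [pchar F].
Proof. by move=> F4; apply: (@card_finPcharP F 2 2). Qed.

Lemma GF4_invD (F : finFieldType) (x y : F) :
  #|F| = 4%N -> GF4_inv (x + y) = GF4_inv x + GF4_inv y.
Proof.
move=> /GF4_pchar2/pcharf0 two0.
by rewrite /GF4_inv sqrrD -mulr_natr two0 mulr0 addr0.
Qed.

Lemma GF4_invM (F : fieldType) (x y : F) :
  GF4_inv (x * y) = GF4_inv x * GF4_inv y.
Proof. exact: exprMn. Qed.

Lemma GF4_inv1 (F : fieldType) : GF4_inv (1 : F) = 1.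
Proof. exact: expr1n. Qed.

Lemma GF4_invK (F : finFieldType) : #|F| = 4%N -> involutive (@GF4_inv F).
Proof. by move=> F4 x; rewrite -[RHS]expf_card F4 /GF4_inv -exprM. Qed.

Lemma GF4_invV (F : finFieldType) (x : F) :
  #|F| = 4%N -> x != 0 -> GF4_inv x = x^-1.
Proof.
move=> F4 x0; apply: (mulfI x0); apply: (mulfI x0).
by rewrite divff // mulr1 -[RHS]expf_card F4 /GF4_inv -!exprS.
Qed.

Lemma GF4_aut (F : finFieldType) (s : {rmorphism F -> F}) :
  #|F| = 4%N -> s =1 id \/ s =1 @GF4_inv F.
Proof.
move=> F4; have [/forallP sid|] := boolP [forall x, s x == x].
  by left=> x; apply/eqP.
case/forallPn=> a sa; right=> x.
have a0 : a != 0 by apply: contraNneq sa => ->; rewrite rmorph0.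
have a1 : a != 1 by apply: contraNneq sa => ->; rewrite rmorph1.
have a2a : a ^+ 2 != a.
  by rewrite -subr_eq0 expr2 -{3}[a]mulr1 -mulrBr mulf_neq0 ?subr_eq0.
have a3 : a ^+ 3 = 1 by apply: (mulfI a0); rewrite -exprS -F4 expf_card mulr1.
have a21 : a ^+ 2 != 1.
  by apply: contraNneq a1 => a21; rewrite -a3 exprS a21 mulr1.
have cov y : y \in [:: 0; 1; a; a ^+ 2].
  have us : uniq [:: 0; 1; a; a ^+ 2].
    rewrite /= !inE !negb_or !(eq_sym _ a) !(eq_sym _ (a ^+ 2)) a0 a1 a2a a21.
    by rewrite expf_neq0 // eq_sym oner_eq0.
  have cs : #|[:: 0; 1; a; a ^+ 2]| = #|F| by rewrite (card_uniqP us) F4.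
  by rewrite (subset_cardP cs (subset_predT _)).
have {}sa : s a = a ^+ 2.
  have := cov (s a); rewrite !inE (negPf sa) fmorph_eq0 (negPf a0) /=.
  by rewrite fmorph_eq1 (negPf a1) /= => /eqP.
have := cov x; rewrite !inE /GF4_inv => /or4P[] /eqP->.
- by rewrite rmorph0 expr0n.
- by rewrite rmorph1 expr1n.
- exact: sa.
- by rewrite rmorphXn /= sa.
Qed.

Lemma GF4_inv_neq_id (F : finFieldType) :
  #|F| = 4%N -> exists x : F, GF4_inv x != x.
Proof.
move=> F4; apply/existsP; apply: contraLR (isT : (2 < 4)%N).
rewrite negb_exists => /forallP id2; rewrite -leqNgt -F4.
suff /subset_leq_card h : F \subset [:: 0; 1 : F].
  exact: leq_trans h (card_size _).
apply/subsetP=> x _; move: (id2 x); rewrite negbK /GF4_inv !inE -subr_eq0.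
by rewrite expr2 -{3}[x]mulr1 -mulrBr mulf_eq0 subr_eq0.
Qed.

(* Main.v *)
Require Import Defs.
From mathcomp Require Import all_boot all_order all_algebra all_fingroup all_field.

Import GRing.Theory.

(** Squaring is the Frobenius automorphism of [GF(4)], so it commutes with
    determinants, and inv-symmetry says that it transposes every principal
    submatrix. Hence every principal minor [d] satisfies [d ^+ 2 = d]. *)

Lemma det_idem_of_sqr_tr (F : fieldType) (char2 : 2 \in [pchar F]%R)
    (n : nat) (M : 'M[F]_n) :
  (forall i j, M j i ^+ 2 = M i j)%R -> (\det M ^+ 2 = \det M)%R.
Proof.
(* The Frobenius map moves inside the determinant and acts entrywise; the extra transpose aligns
   entry [(j, i)] with the hypothesis [symM]. *)
move=> symM; rewrite -[LHS](pFrobenius_autE char2) -det_map_mx -det_tr.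
congr (\det _)%R; apply/matrixP=> i j.
by rewrite !mxE /= pFrobenius_autE symM.
Qed.

Theorem theorem4 (F : finFieldType) (card_F : #|F| = 4)
    (V : finType) (A : V -> V -> F) (symA : inv_symmetric A) :
  principally_unimodular A.
Proof.
move=> Y; have /det_idem_of_sqr_tr idem := @GF4_pchar2 F card_F.
have /idem/eqP : (forall i j, principal_submx A Y j i ^+ 2
                              = principal_submx A Y i j)%R.
  (* The sign in inv-symmetry disappears under squaring. *)
  by move=> i j; rewrite !mxE -[RHS]symA /GF4_inv /trV sqrrN.
(* With [d] the minor, [d ^+ 2 - d] factors as [d * (d - 1)], so [d] is [0] or [1] in the field. *)
rewrite -subr_eq0 expr2 -{3}[(\det _)%R]mulr1 -mulrBr mulf_eq0 subr_eq0.
by rewrite !inE orbA => ->.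
Qed.
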